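(* Let $n\in\{5,6,7\}$ and let $g$ be a positive integer such that $gn\equiv 0 \pmod 2$, $g(n-1)(n-2)\equiv 0\pmod 3$, and $(n,g)\neq(5,2)$. Then a large set of H-designs LH$(n,g,4,3)$ exists, with possible exceptions when $n=5$ and $g\equiv 2\pmod 4$.
   Context: An H-design H$(n,g,k,t)$ is a triple $(Q,G,B)$ where $Q$ is a set of $ng$ points, $G$ is a partition of $Q$ into $n$ groups of size $g$, and $B$ is a set of $k$-subsets of $Q$ (blocks) such that each block meets each group in at most one point and any $t$ points from $t$ distinct groups lie in exactly one block. A large set of H-designs LH$(n,g,k,t)$ is a partition of the set of all $k$-subsets of $Q$ meeting each group of $G$ in at most one point into pairwise disjoint block sets, each of which forms (with $Q$ and $G$) an H-design H$(n,g,k,t)$. (The paper calls parameters ''admissible'' when they satisfy the known necessary and sufficient conditions for existence of an H$(n,g,4,3)$: $gn\equiv0 \pmod 2$, $g(n-1)(n-2)\equiv 0\pmod 3$, $n\ge 4$, $(n,g)\ne(5,2)$.) *)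

(* Defs.v *)
From mathcomp Require Import all_boot.
Unset Printing Implicit Defensive.

(* Point set Q = 'I_n x 'I_g (ng points); the groups of G are the fibres
   {i} x 'I_g of the first projection (n groups of size g). *)
Definition point (n g : nat) := ('I_n * 'I_g)%type.

Definition transverse (n g : nat) (A : {set point n g}) : bool :=
  [forall x in A, forall y in A, (x.1 == y.1) ==> (x == y)].

Definition transverse_ksets (n g k : nat) : {set {set point n g}} :=
  [set A : {set point n g} | (#|A| == k) && @transverse n g A].

Definition is_Hdesign (n g k t : nat) (B : {set {set point n g}}) : Prop :=
  (forall b, b \in B -> (#|b| == k) && @transverse n g b) /\
  (forall T : {set point n g}, #|T| = t -> @transverse n g T ->
     #|[set b in B | T \subset b]| = 1).

Definition is_LH (n g k t : nat) (P : {set {set {set point n g}}}) : Prop :=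
  partition P (transverse_ksets n g k) /\
  (forall B, B \in P -> is_Hdesign n g k t B).

Definition LH_exists (n g k t : nat) : Prop :=
  exists P : {set {set {set point n g}}}, is_LH n g k t P.

(* Main.v *)
(** If [F] colours LH(n,q,4,3), the transverse 4-sets over n groups of size
    q * m are coloured by the pair formed of the [F]-colour of the projection
    [x |-> x %/ m] and of the sum of the coordinates modulo m: a transverse
    triple and a colour then determine the fourth point, first modulo the
    fibres of the projection and then inside a fibre.  The congruences on g thus
    reduce the statement to LH(5,4,4,3), LH(6,3,4,3) and LH(7,2,4,3), for which
    explicit colourings, found by computer search, are checked by evaluation. *)
Require Import Defs.
From mathcomp Require Import all_boot.
From mathcomp Require Import zify.

Set Implicit Arguments.
Unset Strict Implicit.

Lemma map_uniq_inj_in (T1 T2 : eqType) (f : T1 -> T2) (s : seq T1) :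
  uniq (map f s) -> {in s &, injective f}.
Proof.
elim: s => //= a s IHs /andP[fa_notin /IHs injf] x y; rewrite !inE.
case/predU1P=> [->|xs]; case/predU1P=> [->|ys] // eqf.
- by rewrite eqf map_f in fa_notin.
- by rewrite -eqf map_f in fa_notin.
- exact: injf.
Qed.

(** The designs are the colour classes. Naming a colour as that of some [A] limits the condition to
    colours that occur. *)
Lemma LH_of_coloring n g k t (C : eqType) (f : {set point n g} -> C) :
  (forall A T : {set point n g}, A \in transverse_ksets n g k ->
     #|T| = t -> transverse n g T ->
     exists b, [set B in transverse_ksets n g k | (f A == f B) && (T \subset B)]
               = [set b]) ->
  LH_exists n g k t.
Proof.
move=> extT; exists (preim_partition f (transverse_ksets n g k)).
split=> [|_ /imsetP[A kA ->]]; first exact: preim_partitionP.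
split=> [b|T cardT trT]; first by rewrite !inE => /andP[].
apply/eqP/cards1P; have [b eqb] := extT A T kA cardT trT.
by exists b; rewrite -eqb; apply/setP=> B; rewrite !inE -!andbA.
Qed.

(** * Transverse sets and their one-point extensions *)

Section Transverse.

Variables n g : nat.
Implicit Types (A T : {set point n g}) (p : point n g).

Definition fresh p T := [forall x in T, x.1 != p.1].

Lemma transverseP A :
  reflect {in A &, injective (fun x : point n g => x.1)} (transverse n g A).
Proof.
apply: (iffP forall_inP) => [trA x y xA yA eqxy|injA x xA].
  by have /forall_inP/(_ y yA) := trA x xA; rewrite eqxy eqxx => /eqP.
by apply/forall_inP=> y yA; apply/implyP=> /eqP/injA->.
Qed.

Lemma fresh_notin p T : fresh p T -> p \notin T.
Proof. by move/forall_inP=> frp; apply/negP=> /frp; rewrite eqxx. Qed.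

Lemma transverse_setU1 p T :
  p \notin T -> transverse n g (p |: T) = transverse n g T && fresh p T.
Proof.
move=> pT; apply/transverseP/andP=> [inj|[/transverseP injT /forall_inP frp] x y].
  split; first by apply/transverseP; apply: sub_in2 inj => x; apply: setU1r.
  apply/forall_inP=> x xT; apply/eqP=> /inj; rewrite setU11 setU1r //.
  by move=> /(_ isT isT) eqx; rewrite -eqx xT in pT.
rewrite !inE; case/predU1P=> [->|xT]; case/predU1P=> [->|yT] //.
- by move=> eqf; have := frp y yT; rewrite eqf eqxx.
- by move=> eqf; have := frp x xT; rewrite eqf eqxx.
- exact: injT.
Qed.

Lemma transverse_extension T A t : #|T| = t ->
  transverse n g T ->
  (A \in transverse_ksets n g t.+1) && (T \subset A) ->
  exists2 p, fresh p T & A = p |: T.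
Proof.
move=> cardT trT; rewrite inE -andbA => /and3P[/eqP cardA trA sTA].
have /cards1P[p ATp]: #|A :\: T| == 1.
  by rewrite cardsD (setIidPr sTA) cardA cardT subSnn.
have /setDP[pA pT]: p \in A :\: T by rewrite ATp set11.
have eqA : A = p |: T.
  by rewrite -(setID A T) (setIidPr sTA) ATp setUC.
by exists p => //; move: trA; rewrite eqA transverse_setU1 // => /andP[].
Qed.

Lemma setU1_fresh_kset p T t : #|T| = t -> transverse n g T -> fresh p T ->
  p |: T \in transverse_ksets n g t.+1.
Proof.
move=> cardT trT frp; rewrite inE transverse_setU1 ?fresh_notin // trT frp.
by rewrite cardsU1 fresh_notin // cardT eqxx.
Qed.

End Transverse.

(** * Encoding by words *)

Fixpoint words n q : seq (seq nat) :=
  if n is n'.+1 then [seq y :: w | y <- iota 0 q.+1, w <- words n' q]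
  else [:: [::]].

Lemma mem_words n q v :
  (v \in words n q) = (size v == n) && all (fun y => y <= q) v.
Proof.
elim: n v => [|n IHn] [|y v] //.
  by apply/negP; case/allpairsP=> -[y w] [].
rewrite eqSS [all _ _]/=; apply/allpairsP/andP.
  case=> [[z w]] /= [+ wn [-> ->]]; move: wn; rewrite IHn => /andP[-> ->].
  by rewrite -[_ :: _]/(iota 0 q.+1) mem_iota andbT.
case=> [sz /andP[yq qv]]; exists (y, v); split; rewrite //= ?IHn ?sz //.
by rewrite -[_ :: _]/(iota 0 q.+1) mem_iota.
Qed.

(** A transverse set over n groups of size q is encoded by the word of length n
    whose i-th letter is [y.+1] if the set contains the point [(i, y)], and 0 if
    the set misses group i. *)
Definition extensions n q (v : seq nat) : seq (nat * nat) :=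
  [seq (j, y) | j <- [seq j <- iota 0 n | nth 0 v j == 0], y <- iota 1 q].

(** A word with [t] nonzero letters has [(n - t) * q] extensions, so each colour occurs on exactly
    one of them. *)
Definition rainbow n q t (F : seq nat -> nat) :=
  all (fun v => perm_eq [seq F (set_nth 0 v e.1 e.2) | e <- extensions n q v]
                        (iota 0 ((n - t) * q)))
      [seq v <- words n q | count (predC1 0) v == t].

(** * The product construction *)

Section Product.

Variables n q m : nat.
Implicit Types (A T : {set point n (q * m)}) (p : point n (q * m)).

(** For a transverse [A] the sum has at most one term; the empty sum is the code 0 of a missed
    group. *)
Definition letter A (i : 'I_n) := \sum_(p in A | p.1 == i) (p.2 %/ m).+1.
Definition profile A := codom (letter A).

Lemma modulus_gt0 p : 0 < m.
Proof.
by have := leq_ltn_trans (leq0n _) (ltn_ord p.2); rewrite muln_gt0 => /andP[].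
Qed.

Lemma ltn_div p : p.2 %/ m < q.
Proof. by rewrite ltn_divLR ?ltn_ord // (modulus_gt0 p). Qed.

Lemma size_profile A : size (profile A) = n.
Proof. by rewrite size_codom card_ord. Qed.

Lemma nth_profile A (i : 'I_n) : nth 0 (profile A) i = letter A i.
Proof.
rewrite /profile codomE (nth_map i) ?size_enum_ord //.
by congr letter; apply: val_inj; rewrite /= nth_enum_ord.
Qed.

Lemma letter_eq0 A i : (letter A i == 0) = [forall x in A, x.1 != i].
Proof.
rewrite sum_nat_eq0; apply/forallP/forall_inP=> [H x xA|H x].
  by have := H x; rewrite xA; case: eqP.
by apply/implyP=> /andP[/H/negPf->].
Qed.

Lemma letter_transverse A p : transverse n (q * m) A -> p \in A ->
  letter A p.1 = (p.2 %/ m).+1.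
Proof.
move=> /transverseP injA pA; rewrite /letter (big_pred1 p) // => x /=.
by apply/andP/eqP=> [[xA /eqP/injA->] | ->].
Qed.

Lemma letter_le A i : transverse n (q * m) A -> letter A i <= q.
Proof.
move=> trA; have [/eqP-> //|] := boolP (letter A i == 0).
rewrite letter_eq0 negb_forall => /existsP[p].
rewrite negb_imply negbK => /andP[pA /eqP <-].
by rewrite letter_transverse // ltn_div.
Qed.

Lemma count_profile A : transverse n (q * m) A ->
  count (predC1 0) (profile A) = #|A|.
Proof.
move=> trA; rewrite -(card_in_imset (elimT (transverseP A) trA)).
rewrite /profile /codom /image_mem count_map -size_filter cardE.
rewrite /(enum [set _ | _ in A]) -enumT; congr size; apply: eq_filter => i /=.
rewrite letter_eq0; apply/forall_inPn/imsetP=> [[x xA]|[x xA ->]].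
  by rewrite negbK => /eqP <-; exists x.
by exists x => //; rewrite negbK.
Qed.

Lemma profile_setU1 p T : fresh p T ->
  profile (p |: T) = set_nth 0 (profile T) p.1 (p.2 %/ m).+1.
Proof.
move=> frp; apply: (@eq_from_nth _ 0) => [|j].
  by rewrite size_set_nth !size_profile; apply/esym/maxn_idPr/ltn_ord.
rewrite size_profile => ltjn; rewrite nth_set_nth /=.
rewrite -[j]/(nat_of_ord (Ordinal ltjn)) !nth_profile /letter.
case: eqP => [/val_inj eqj|neqj]; last first.
  apply: eq_bigl => x; rewrite !inE; case: eqP => [->|] //=.
  by case: eqP => [eqj|_]; [case: neqj; rewrite eqj | rewrite andbF].
rewrite (big_pred1 p) // => x; rewrite !inE /= eqj.
case: (eqVneq x p) => [->|_] /=; first by rewrite -val_eqE /= eqxx.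
apply/andP=> -[xT]; have /forall_inP/(_ x xT) := frp.
by rewrite -val_eqE /= => /negPf->.
Qed.

Lemma extension_of_fresh p T : transverse n (q * m) T -> fresh p T ->
  (val p.1, (p.2 %/ m).+1) \in extensions n q (profile T).
Proof.
move=> trT frp; apply/allpairsP; exists (val p.1, (p.2 %/ m).+1); split=> //=.
  by rewrite mem_filter mem_iota nth_profile letter_eq0 [X in X && _]frp /=.
by rewrite mem_iota /= add1n ltnS ltn_div.
Qed.

Lemma LH_of_rainbow t F : rainbow n q t F -> LH_exists n (q * m) t.+1 t.
Proof.
move=> /allP rbF.
have rb T : #|T| = t -> transverse n (q * m) T ->
    perm_eq [seq F (set_nth 0 (profile T) e.1 e.2)
            | e <- extensions n q (profile T)] (iota 0 ((n - t) * q)).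
  move=> cardT trT; apply: rbF.
  rewrite mem_filter count_profile // cardT eqxx mem_words size_profile eqxx /=.
  by apply/allP=> _ /codomP[i ->]; apply: letter_le.
pose f A := (F (profile A), (\sum_(x in A) x.2) %% m).
apply: (@LH_of_coloring _ _ _ _ _ f) => A T kA cardT trT.
have [p0 p0A]: exists p, p \in A.
  by apply/set0Pn; rewrite -card_gt0; move: kA; rewrite inE => /andP[/eqP->].
have m_gt0 := modulus_gt0 p0.
(* [A] is an extension of [A :\ p0], so its colour lies in the range. *)
have FA : F (profile A) \in iota 0 ((n - t) * q).
  have p0A' : p0 \notin A :\ p0 by rewrite setD11.
  have cardA' : #|A :\ p0| = t.
    apply/eqP; move: kA; rewrite inE => /andP[+ _].
    by rewrite (cardsD1 p0 A) p0A add1n eqSS.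
  move: kA; rewrite inE -{2}(setD1K p0A) transverse_setU1 // => /and3P[_ trA' fr].
  rewrite -(perm_mem (rb _ cardA' trA')) -{1}(setD1K p0A) profile_setU1 //.
  apply/mapP; exists (val p0.1, (p0.2 %/ m).+1) => //; exact: extension_of_fresh.
have Fext := rb T cardT trT.
have injF : {in extensions n q (profile T) &,
               injective (fun e => F (set_nth 0 (profile T) e.1 e.2))}.
  by apply: map_uniq_inj_in; rewrite (perm_uniq Fext) iota_uniq.
move: FA; rewrite -(perm_mem Fext) => /mapP[[j y0] eE FA].
have /allpairsP[[j' y'] /= [+ + [ej ey]]] := eE; rewrite -{}ej -{}ey.
rewrite mem_filter !mem_iota /= add1n => /andP[vj0 ltjn].
case: y0 eE FA => // y eE FA; rewrite !ltnS /= => ltyq.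
set s := \sum_(x in T) x.2.
have sum_fresh p : fresh p T -> \sum_(x in p |: T) x.2 = s + p.2.
  by move=> frp; rewrite big_setU1 ?fresh_notin //= addnC.
(* The remainder that gives the new set the same sum modulo [m] as [A]; [m - s %% m] plays the role
   of [- s]. *)
pose r := (\sum_(x in A) x.2 + (m - s %% m)) %% m.
have ltrm : r < m by rewrite ltn_mod.
have ltp : y * m + r < q * m.
  apply: (@leq_trans (y.+1 * m)); last by rewrite leq_mul2r ltyq orbT.
  by rewrite mulSn addnC ltn_add2r.
pose p : point n (q * m) := (Ordinal ltjn, Ordinal ltp).
have pdiv : p.2 %/ m = y by rewrite /= divnMDl // divn_small // addn0.
have frp : fresh p T by rewrite /fresh -letter_eq0 -nth_profile.
have fp : f (p |: T) = f A.
  congr pair; first by rewrite FA profile_setU1 // pdiv.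
  rewrite sum_fresh //= addnCA modnMDl modnDmr -modnDml addnCA subnKC ?modnDr //.
  exact/ltnW/ltn_pmod.
exists (p |: T); apply/setP=> B; apply/idP/set1P=> [|->]; last first.
  by rewrite inE (setU1_fresh_kset cardT trT frp) fp eqxx subsetUr.
rewrite inE => /and3P[kB /eqP fAB sTB].
have [p' frp' eqB] := transverse_extension cardT trT (introT andP (conj kB sTB)).
move: fAB; rewrite -fp {}eqB; case=> eqF eqsum; congr (_ |: _).
rewrite !profile_setU1 // in eqF.
have := injF _ _ (extension_of_fresh trT frp) (extension_of_fresh trT frp') eqF.
case=> eqj eqdiv; move: eqsum; rewrite !sum_fresh // => /eqP.
rewrite eqn_modDl => /eqP eqmod.
rewrite [p']surjective_pairing [p]surjective_pairing; congr pair; apply: val_inj => //.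
by rewrite /= (divn_eq p'.2 m) (divn_eq (y * m + r) m) -eqdiv -eqmod.
Qed.

End Product.

(** * The three explicit colourings *)

(** Colours of LH(5,4,4,3) and LH(7,2,4,3) are vectors of F_2^3, encoded as
    numbers below 8 whose sum is [Nat.lxor]. *)
Definition xor_sum := foldr Nat.lxor 0.

Definition letters (v : seq nat) := [seq y <- v | y != 0].

(** When only group i is missed, the colour is an affine function of the four
    letters, seen in F_2^2: its constant term is [i] and the entries of row i
    are the images of the basis vectors. *)
Definition linear_part5 : seq (seq (nat * nat)) :=
  [:: [:: (2, 4); (1, 4); (2, 5); (1, 2)];
      [:: (2, 4); (1, 6); (6, 3); (3, 4)];
      [:: (5, 4); (6, 1); (7, 4); (5, 2)];
      [:: (2, 7); (5, 6); (4, 3); (6, 2)];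
      [:: (2, 3); (3, 4); (2, 5); (2, 4)]].

Definition color5 (v : seq nat) :=
  let i := index 0 v in
  (* The list tabulates the linear map at 0, e1, e2 and e1 + e2; the letter [y] stands for the
     vector encoded by [y.-1]. *)
  let image uy := nth 0 [:: 0; uy.1.1; uy.1.2; Nat.lxor uy.1.1 uy.1.2] uy.2.-1 in
  Nat.lxor i
    (xor_sum [seq image uy | uy <- zip (nth [::] linear_part5 i) (letters v)]).

Definition support (v : seq nat) := [seq j <- iota 0 (size v) | nth 0 v j != 0].

Definition find_row (T : Type) (tbl : seq (seq nat * T)) (v : seq nat) :=
  ohead [seq r.2 | r <- tbl & r.1 == support v].

(** The colouring is equivariant for the cyclic shift of the groups, acting on
    F_8 = F_2[x]/(x^3+x+1) as multiplication by x; a row contains the constant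
    term and the linear coefficients for one representative of each orbit of
    supports. *)
Definition affine_form7 : seq (seq nat * (nat * seq nat)) :=
  [:: ([:: 0; 1; 2; 3], (7, [:: 1; 6; 6; 2]));
      ([:: 0; 1; 2; 4], (0, [:: 1; 4; 6; 2]));
      ([:: 0; 1; 2; 5], (4, [:: 6; 3; 4; 5]));
      ([:: 0; 1; 3; 4], (4, [:: 7; 1; 3; 7]));
      ([:: 0; 1; 3; 5], (6, [:: 3; 2; 4; 4]))].

(** Doubling raises degrees by one; 11 encodes x^3+x+1 and cancels a term of degree 3. *)
Definition mulX (c : nat) := Nat.lxor c.*2 (if c < 4 then 0 else 11).

Fixpoint color7_rec fuel (v : seq nat) :=
  match find_row affine_form7 v, fuel with
  | Some (a, us), _ =>
      Nat.lxor a (xor_sum [seq uy.1 * uy.2.-1 | uy <- zip us (letters v)])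
  (* [rot 1] moves each group back by one, and the factor x compensates. *)
  | None, k.+1 => mulX (color7_rec k (rot 1 v))
  | None, 0 => 0
  end.

(** The colouring is invariant under the permutation of order 9 sending point
    [(i, y)] to [(i + 1, y)], except that [(2, y)] and [(5, y)] are sent to
    [(0, y + 1)] and [(3, y + 1)].  Each orbit contains one set with a support
    below and first letter 1; its colour is read in the row at the position
    given by the base 3 expansion of the other letters. *)
Definition orbit_color6 : seq (seq nat * seq nat) :=
  [:: ([:: 0; 1; 2; 3],
       [:: 5; 0; 8; 2; 4; 1; 7; 6; 3; 4; 1; 2; 7; 6; 3; 8; 5; 0;
           7; 6; 3; 0; 8; 5; 1; 2; 4]);
      ([:: 0; 1; 3; 4],
       [:: 3; 0; 1; 2; 7; 8; 5; 4; 6; 2; 3; 5; 0; 4; 7; 6; 8; 1;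
           8; 4; 3; 7; 5; 1; 2; 6; 0]);
      ([:: 0; 1; 3; 5],
       [:: 6; 4; 8; 5; 3; 1; 2; 0; 7; 1; 0; 6; 3; 2; 8; 5; 7; 4;
           5; 6; 2; 4; 0; 3; 7; 1; 8]);
      ([:: 0; 1; 4; 5],
       [:: 4; 6; 0; 8; 1; 3; 7; 5; 2; 8; 4; 7; 6; 5; 1; 2; 3; 0;
           3; 5; 4; 1; 7; 0; 8; 2; 6]);
      ([:: 0; 3; 4; 5],
       [:: 0; 7; 1; 7; 2; 5; 4; 8; 7; 6; 1; 5; 2; 8; 6; 0; 6; 4;
           1; 8; 3; 0; 3; 2; 3; 4; 5])].

(** The inverse of this permutation; [pred] cycles the letters 1, 2, 3 and keeps 0, the mark of a
    missed group. *)
Definition turn6 (v : seq nat) :=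
  let pred y := nth 0 [:: 0; 3; 1; 2] y in
  [:: nth 0 v 1; nth 0 v 2; pred (nth 0 v 0);
      nth 0 v 4; nth 0 v 5; pred (nth 0 v 3)].

Fixpoint color6_rec fuel (v : seq nat) :=
  match find_row orbit_color6 v, letters v, fuel with
  | Some row, 1 :: ys, _ => nth 0 row (foldl (fun a y => 3 * a + y.-1) 0 ys)
  | _, _, k.+1 => color6_rec k (turn6 v)
  | _, _, 0 => 0
  end.

Lemma rainbow5 : rainbow 5 4 3 color5.
Proof. by vm_compute. Qed.

Lemma rainbow6 : rainbow 6 3 3 (color6_rec 9).
Proof. by vm_compute. Qed.

Lemma rainbow7 : rainbow 7 2 3 (color7_rec 7).
Proof. by vm_compute. Qed.

Theorem theorem14 (n g : nat) :
  n \in [:: 5; 6; 7] -> 0 < g ->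
  g * n = 0 %[mod 2] ->
  g * (n - 1) * (n - 2) = 0 %[mod 3] ->
  (n, g) <> (5, 2) ->
  ~ (n = 5 /\ g = 2 %[mod 4]) ->
  LH_exists n g 4 3.
Proof.
rewrite !inE => /or3P[] /eqP-> _ even_ng dvd3 _ not2mod4.
(* For n = 5, [g] is even and not 2 modulo 4; for n = 6, 3 divides 20g; for n = 7, 7g is even. *)
- have /divnK <- : 4 %| g by lia.
  rewrite mulnC; exact: LH_of_rainbow rainbow5.
- have /divnK <- : 3 %| g by lia.
  rewrite mulnC; exact: LH_of_rainbow rainbow6.
- have /divnK <- : 2 %| g by lia.
  rewrite mulnC; exact: LH_of_rainbow rainbow7.
Qed.
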